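(* If $\eta>k^2$ and $k^2<\bar\alpha$, then the matrix $A+\eta B^TL^{-1}B-k^2M$ is symmetric positive definite.
   Context: Let $m\le n$ and let $k$, $\eta$ be real numbers. $A\in\mathbb{R}^{n\times n}$ is symmetric positive semidefinite with $\dim\ker(A)=m$; $M\in\mathbb{R}^{n\times n}$ is symmetric positive definite; $B\in\mathbb{R}^{m\times n}$ has full row rank; $C\in\mathbb{R}^{n\times m}$ is a matrix whose columns form a basis of $\ker(A)$ (so $AC=0$) and satisfies $MC=B^T$; and $L=BC\in\mathbb{R}^{m\times m}$ (so $L=C^TMC$ is symmetric positive definite). Then $\mathbb{R}^n=\ker(A)\oplus\ker(B)$. Standing assumption: both $\mathcal{K}=\begin{pmatrix} A-k^2M & B^T\\ B & 0\end{pmatrix}$ and $A-k^2M$ are nonsingular. $\bar\alpha>0$ is a constant such that $u^TAu\ge\bar\alpha\,u^TMu$ for all $u\in\ker(B)$. *)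

(* Defs.v *)
From mathcomp Require Import all_boot all_order all_algebra reals.

Set Implicit Arguments.
Unset Strict Implicit.
Unset Printing Implicit Defensive.
Import Order.TTheory GRing.Theory Num.Theory.
Local Open Scope ring_scope.

Definition sym_posdef (R : realType) (n : nat) (A : 'M[R]_n) : Prop :=
  A^T = A /\ forall u : 'cV[R]_n, u != 0 -> 0 < (u^T *m A *m u) 0 0.

Definition sym_possemidef (R : realType) (n : nat) (A : 'M[R]_n) : Prop :=
  A^T = A /\ forall u : 'cV[R]_n, 0 <= (u^T *m A *m u) 0 0.

(* A subspace is represented by the row space of a matrix, and [kermx] is
   the left kernel, so the null space {u | A u = 0} of column vectors is the
   row space of [kermx A^T]; see [ker_colP]. *)
Definition ker_col (R : realType) (m n : nat) (A : 'M[R]_(m, n)) : 'M[R]_n :=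
  kermx A^T.

Lemma ker_colP (R : realType) (m n : nat) (A : 'M[R]_(m, n)) (u : 'cV[R]_n) :
  reflect (A *m u = 0) (u^T <= ker_col A)%MS.
Proof.
apply: (iffP sub_kermxP) => [h|h]; last by rewrite -trmx_mul h trmx0.
by apply: trmx_inj; rewrite trmx_mul h trmx0.
Qed.

Definition cols_basis_ker (R : realType) (m n p : nat)
    (C : 'M[R]_(n, p)) (A : 'M[R]_(m, n)) : Prop :=
  row_free C^T /\ (C^T :=: ker_col A)%MS.

(* Main.v *)
(* Since [B = C^T M], every [u] splits as [u = w + c] with [B w = 0] and
   [c = C (L^-1 B u)] in [ker A], and [w], [c] are [M]-orthogonal. The quadratic
   form then decouples as
   [(w^T A w - k^2 w^T M w) + (eta - k^2) c^T M c], where the first term is at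
   least [(alpha - k^2) w^T M w]. *)
Require Import Defs.
From mathcomp Require Import all_boot all_order all_algebra reals.

Set Implicit Arguments.
Unset Strict Implicit.
Unset Printing Implicit Defensive.
Import Order.TTheory GRing.Theory Num.Theory.
Local Open Scope ring_scope.

Lemma sym_posdef_ge0 (R : realType) (n : nat) (M : 'M[R]_n) (u : 'cV[R]_n) :
  sym_posdef M -> 0 <= (u^T *m M *m u) 0 0.
Proof.
case=> _ M_gt0; have [->|u_neq0] := eqVneq u 0; last exact/ltW/M_gt0.
by rewrite mulmx0 mxE.
Qed.

(** A nonzero row [v] with [v M = 0] would give [v M v^T = 0], against positivity at [v^T]; so the
    left kernel is trivial. *)
Lemma sym_posdef_unitmx (R : realType) (n : nat) (M : 'M[R]_n) :
  sym_posdef M -> M \in unitmx.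
Proof.
case=> _ M_gt0; rewrite -row_free_unit -kermx_eq0.
apply/rowV0P => v /sub_kermxP vM0; apply/eqP; apply: contraTT isT => v_neq0.
have vT_neq0 : v^T != 0.
  by apply: contraNneq v_neq0 => vT0; rewrite -[v]trmxK vT0 trmx0.
by have := M_gt0 _ vT_neq0; rewrite trmxK vM0 mul0mx mxE ltxx.
Qed.

(** Independent columns make [C] injective, so the form at [u] is that of [M] at the nonzero vector
    [C u]. This serves for [L = C^T M C]. *)
Lemma sym_posdef_congr (R : realType) (m n : nat) (M : 'M[R]_n)
    (C : 'M[R]_(n, m)) :
  sym_posdef M -> row_free C^T -> sym_posdef (C^T *m M *m C).
Proof.
case=> M_sym M_gt0 C_free; split=> [|u u_neq0].
  by rewrite !trmx_mul trmxK M_sym mulmxA.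
have Cu_neq0 : C *m u != 0.
  apply: contraNneq u_neq0 => Cu0; apply/eqP/trmx_inj/(row_free_inj C_free).
  by rewrite -trmx_mul Cu0 !trmx0 mul0mx.
by have := M_gt0 _ Cu_neq0; rewrite trmx_mul !mulmxA.
Qed.

Theorem theorem3p2 (R : realType) (m n : nat) (k eta alpha : R)
    (A M : 'M[R]_n) (B : 'M[R]_(m, n)) (C : 'M[R]_(n, m)) (L : 'M[R]_m)
    (le_mn : (m <= n)%N)
    (A_psd : sym_possemidef A)
    (dim_kerA : \rank (ker_col A) = m)
    (M_pd : sym_posdef M)
    (B_full : row_free B)
    (C_basis : cols_basis_ker C A)
    (MC : M *m C = B^T)
    (L_def : L = B *m C)
    (K_nonsing : block_mx (A - k ^+ 2 *: M) B^T B 0 \in unitmx)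
    (AkM_nonsing : A - k ^+ 2 *: M \in unitmx)
    (alpha_gt0 : 0 < alpha)
    (A_coercive : forall u : 'cV[R]_n, B *m u = 0 ->
       alpha * (u^T *m M *m u) 0 0 <= (u^T *m A *m u) 0 0)
    (lt_k_eta : k ^+ 2 < eta)
    (lt_k_alpha : k ^+ 2 < alpha) :
  sym_posdef (A + eta *: (B^T *m invmx L *m B) - k ^+ 2 *: M).
Proof.
have [A_sym _] := A_psd; have [M_sym M_gt0] := M_pd.
have [C_free C_ker] := C_basis.
have AC : A *m C = 0.
  apply: trmx_inj; rewrite trmx_mul trmx0; apply/sub_kermxP.
  by rewrite -/(ker_col A) -C_ker.
have B_def : B = C^T *m M by rewrite -[LHS]trmxK -MC trmx_mul M_sym.
have L_pd : sym_posdef L.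
  by rewrite L_def B_def; apply: sym_posdef_congr.
have L_unit := sym_posdef_unitmx L_pd; have [L_sym _] := L_pd.
split=> [|u u_neq0].
  rewrite !(linearB, linearD, linearZ) /= !trmx_mul trmxK trmx_inv.
  by rewrite A_sym L_sym M_sym mulmxA.
(* The coefficients [y] solve [L y = B u]; since [L = B C], this says [B c = B u], which puts [w] in
   the kernel of [B]. *)
pose y := invmx L *m (B *m u); pose c := C *m y; pose w := u - c.
have Ac : A *m c = 0 by rewrite mulmxA AC mul0mx.
have Bw : B *m w = 0 by rewrite mulmxBr /c mulmxA -L_def mulKVmx // subrr.
have Mc : M *m c = B^T *m y by rewrite mulmxA MC.
have u_def : u = w + c by rewrite subrK.
clearbody w c.
(* Orthogonality: [w^T M c = w^T B^T y = (B w)^T y = 0]. *)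
have wMc : w^T *m (M *m c) = 0 by rewrite Mc mulmxA -trmx_mul Bw trmx0 mul0mx.
have cMw : c^T *m (M *m w) = 0.
  by apply: trmx_inj; rewrite !trmx_mul trmxK M_sym -mulmxA wMc trmx0.
have cA : c^T *m A = 0 by rewrite -A_sym -trmx_mul Ac trmx0.
(* The augmentation term sees only [c]: [B^T L^-1 B u = B^T y = M c]. Hence [u] is split only in the
   [A] and [M] terms. *)
have Su : (A + eta *: (B^T *m invmx L *m B) - k ^+ 2 *: M) *m u
    = A *m w - k ^+ 2 *: (M *m w) + (eta - k ^+ 2) *: (M *m c).
  rewrite mulmxBl mulmxDl -!scalemxAl -!mulmxA -/y -Mc.
  by rewrite {1 2}u_def !mulmxDr Ac addr0 scalerDr scalerBl opprD addrACA.
have -> : u^T *m (A + eta *: (B^T *m invmx L *m B) - k ^+ 2 *: M) *m u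
    = w^T *m A *m w - k ^+ 2 *: (w^T *m M *m w)
      + (eta - k ^+ 2) *: (c^T *m M *m c).
  have uT_def : u^T = w^T + c^T by rewrite [in LHS]u_def [LHS]linearD.
  rewrite -mulmxA Su uT_def mulmxDl !mulmxDr !mulmxN -!scalemxAr.
  rewrite wMc cMw (mulmxA c^T A) cA mul0mx !scaler0 oppr0 !addr0 !add0r.
  by rewrite -!mulmxA.
have wA_ge := A_coercive w Bw.
have wM_ge0 := sym_posdef_ge0 w M_pd; have cM_ge0 := sym_posdef_ge0 c M_pd.
(* The patterns push the entry [0 0] through sums, opposites and scalings only, so that [mxE] does
   not expand the matrix products. *)
rewrite mxE [X in X + _]mxE [X in _ + X + _]mxE [X in _ - X + _]mxE.
rewrite [X in _ < _ + X]mxE.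
have cpart_ge0 : 0 <= (eta - k ^+ 2) * (c^T *m M *m c) 0 0.
  by rewrite mulr_ge0 // subr_ge0 ltW.
have wpart_ge : (alpha - k ^+ 2) * (w^T *m M *m w) 0 0
    <= (w^T *m A *m w) 0 0 - k ^+ 2 * (w^T *m M *m w) 0 0.
  by rewrite mulrBl lerD2r.
(* Both parts are nonnegative. The [w] part is strictly positive if [w != 0]; otherwise [c = u] is
   nonzero and the [c] part is. *)
have [w0|w_neq0] := eqVneq w 0; last first.
  rewrite ltr_wpDr //; apply: lt_le_trans wpart_ge.
  by rewrite mulr_gt0 ?subr_gt0 // M_gt0.
have c_neq0 : c != 0 by move: u_neq0; rewrite u_def w0 add0r.
rewrite ltr_wpDl //; last by rewrite mulr_gt0 ?subr_gt0 // M_gt0.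
by apply: le_trans wpart_ge; rewrite mulr_ge0 // subr_ge0 ltW.
Qed.
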